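(* Let $F=\mathbb{Q}(\sqrt{-15})\subset\mathbb{C}$ and let $$A_{01}=-\tfrac18+\tfrac{\sqrt{15}}{8}i,\quad A_{10}=-2,\quad A_{23}=-\tfrac34+\tfrac{\sqrt{15}}{4}i,\quad A_{32}=\tfrac12-\tfrac{\sqrt{15}}{6}i.$$ Let $$\beta(W)=4[-2]+2\left([A_{01}]+[\overline{A_{01}}]+[A_{23}]+[\overline{A_{23}}]+[A_{32}]+[\overline{A_{32}}]\right)\in\mathcal{P}(F),$$ the invariant of the CR triangulation of the Whitehead link complement $W$ by four ideal CR tetrahedra. Then: (1) $\beta(W)=4[\frac12]$ in $\mathcal{P}(F)$. (2) $\delta(\beta(W))=0$, hence $\beta(W)\in\mathcal{B}(F)$. (3) $\beta(W)$ has order $3$ in $\mathcal{B}(F)$.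
   Context: Pre-Bloch group: for a field $F$, $\mathcal{P}(F)$ is the quotient of the free abelian group $\mathbb{Z}[F\setminus\{0,1\}]$ by the subgroup generated by $[x]-[y]+[\frac{y}{x}]-[\frac{1-x^{-1}}{1-y^{-1}}]+[\frac{1-x}{1-y}]$ for $x\neq y$ in $F\setminus\{0,1\}$. $\bigwedge^2F^*$ is $F^*\otimes_{\mathbb{Z}}F^*$ modulo the subgroup generated by all $x\otimes y+y\otimes x$. The Bloch group $\mathcal{B}(F)$ is the kernel of $\delta:\mathcal{P}(F)\to\bigwedge^2F^*$, $\delta([z])=z\wedge(1-z)$. The four CR tetrahedra $A,B,C,D$ of the triangulation of $W$ have the known cross-ratio invariants: $A_{ij}$ as in the statement; $B_{01}=-2$, $B_{10}=\overline{A_{01}}$, $B_{23}=\overline{A_{32}}$, $B_{32}=\overline{A_{23}}$; $C_{01}=\overline{A_{01}}$, $C_{10}=-2$, $C_{23}=\overline{A_{23}}$, $C_{32}=\overline{A_{32}}$; $D_{01}=-2$, $D_{10}=A_{01}$, $D_{23}=A_{32}$, $D_{32}=A_{23}$. The invariant $\beta(W)$ is the sum over the four tetrahedra $T$ of $[T_{01}]+[T_{10}]+[T_{23}]+[T_{32}]$, which is the expression displayed in the statement. *)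

(* Defs.v *)
From HB Require Import structures.
From mathcomp Require Import all_boot all_order all_algebra.
From mathcomp Require Import generic_quotient ring_quotient.
From mathcomp Require Import ring.
From mathcomp Require Import boolp reals.
From mathcomp.real_closed Require Import complex.
From mathcomp.multinomials Require Import freeg.

Set Implicit Arguments.
Unset Strict Implicit.
Unset Printing Implicit Defensive.

Import Order.TTheory GRing.Theory Num.Theory.
Export Quotient.Exports.

Local Open Scope ring_scope.
Local Open Scope quotient_scope.

(* The subgroup generated by the elements satisfying rel. *)
Definition zspan (V : zmodType) (rel : V -> Prop) : {pred V} :=
  fun x => `[< forall S : {pred V}, zmod_closed S ->
                 (forall r, rel r -> r \in S) -> x \in S >].

Section Zquot.
Variables (V : zmodType) (rel : V -> Prop).

Lemma zspan_closed : zmod_closed (zspan rel).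
Proof.
split=> [|x y /asboolP xS /asboolP yS]; apply/asboolP => S cS relS.
  by case: cS.
by case: (cS) => _; apply; [apply: xS | apply: yS].
Qed.

HB.instance Definition _ :=
  GRing.isZmodClosed.Build V (zspan rel) zspan_closed.

Definition zquot : Type := Quotient.quot (zspan rel).
HB.instance Definition _ := GRing.Zmodule.on zquot.

(* [zpi] and [zlift] are locked only to keep unification away from the
   choice of representatives made by the generic quotient. *)
Fact zpi_key : unit. Proof. by []. Qed.
Definition zpi : V -> zquot :=
  locked_with zpi_key (fun x => \pi_(Quotient.quot (zspan rel)) x).

Lemma zpiE x : zpi x = \pi_(Quotient.quot (zspan rel)) x.
Proof. by rewrite /zpi unlock. Qed.

Lemma zpi_is_additive : zmod_morphism zpi.
Proof. by move=> x y; rewrite !zpiE; apply: pi_is_zmod_morphism. Qed.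
HB.instance Definition _ :=
  GRing.isZmodMorphism.Build V zquot zpi zpi_is_additive.

Lemma zpi_rel r : rel r -> zpi r = 0.
Proof.
have z0 : zpi 0 = 0 by exact: raddf0.
move=> rr; rewrite -z0 !zpiE; apply/eqP.
rewrite -Quotient.idealrBE subr0.
by apply/asboolP => S _; apply.
Qed.

Lemma zquotW (P : zquot -> Prop) : (forall x, P (zpi x)) -> forall q, P q.
Proof. by move=> Px q; rewrite -[q]reprK -zpiE; apply: Px. Qed.

Section Lift.
Variables (W : zmodType) (f : {additive V -> W}).
Hypothesis f_rel : forall r, rel r -> f r = 0.

Fact zlift_key : unit. Proof. by []. Qed.
Definition zlift of (forall r, rel r -> f r = 0) : zquot -> W :=
  locked_with zlift_key (fun q => f (repr (q : Quotient.quot (zspan rel)))).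

Lemma zspan_ker x : x \in zspan rel -> f x = 0.
Proof.
move=> /asboolP /(_ [pred y | f y == 0]) H; apply/eqP; apply: H => /=.
  split=> [|y z]; rewrite !inE ?raddf0 // raddfB.
  by move=> /eqP-> /eqP->; rewrite subr0.
by move=> r rr; rewrite inE f_rel.
Qed.

Lemma zliftE x : zlift f_rel (zpi x) = f x.
Proof.
rewrite /zlift zpiE unlock.
apply/eqP; rewrite -subr_eq0 -raddfB zspan_ker //.
by rewrite Quotient.idealrBE reprK.
Qed.

Lemma zlift_is_additive : zmod_morphism (zlift f_rel).
Proof.
apply: zquotW => x; apply: zquotW => y.
by rewrite -raddfB !zliftE raddfB.
Qed.
HB.instance Definition _ :=
  GRing.isZmodMorphism.Build zquot W (zlift f_rel) zlift_is_additive.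
End Lift.
End Zquot.

Section FreegLift.
Variables (K : choiceType) (M : zmodType) (f : K -> M).

Definition fgext : {freeg K / int} -> M := fglift (f : K -> zmodule M).

Lemma fgext_is_additive : zmod_morphism fgext.
Proof. by have H := lift_is_additive (f : K -> zmodule M) => x y; apply: H. Qed.
HB.instance Definition _ :=
  GRing.isZmodMorphism.Build {freeg K / int} M fgext fgext_is_additive.

Lemma fgextU k : fgext << k >> = f k.
Proof. by rewrite /fgext liftU scale1r. Qed.
End FreegLift.

Section Tensor.
Variables A B : zmodType.
Local Notation Z2 := {freeg (A * B)%type / int}.

Definition tensor_rel (r : Z2) : Prop :=
  (exists a a' b, r = << (a + a', b) >> - << (a, b) >> - << (a', b) >>) \/
  (exists a b b', r = << (a, b + b') >> - << (a, b) >> - << (a, b') >>).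

Definition tensor : Type := zquot tensor_rel.
HB.instance Definition _ := GRing.Zmodule.on tensor.

Definition tens (a : A) (b : B) : tensor := zpi tensor_rel << (a, b) >>.

Lemma tensDl a a' b : tens (a + a') b = tens a b + tens a' b.
Proof.
apply/eqP; rewrite -subr_eq0 opprD addrA -!raddfB /=.
by apply/eqP/zpi_rel; left; exists a, a', b.
Qed.

Lemma tensDr a b b' : tens a (b + b') = tens a b + tens a b'.
Proof.
apply/eqP; rewrite -subr_eq0 opprD addrA -!raddfB /=.
by apply/eqP/zpi_rel; right; exists a, b, b'.
Qed.
End Tensor.

Section Wedge.
Variable A : zmodType.

Definition wedge_rel (r : tensor A A) : Prop :=
  exists x y, r = tens x y + tens y x.

(* Only 2 (x /\ x) = 0 is imposed, not x /\ x = 0. *)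
Definition wedge2 : Type := zquot wedge_rel.
HB.instance Definition _ := GRing.Zmodule.on wedge2.

Definition wedge (x y : A) : wedge2 := zpi wedge_rel (tens x y).

Lemma wedgeDl x x' y : wedge (x + x') y = wedge x y + wedge x' y.
Proof. by rewrite /wedge tensDl raddfD. Qed.

Lemma wedgeDr x y y' : wedge x (y + y') = wedge x y + wedge x y'.
Proof. by rewrite /wedge tensDr raddfD. Qed.

Lemma wedgeC x y : wedge y x = - wedge x y.
Proof.
apply/eqP; rewrite -addr_eq0 -raddfD /=.
by apply/eqP/zpi_rel; exists y, x.
Qed.

Lemma wedge0l y : wedge 0 y = 0.
Proof. by apply: (addrI (wedge 0 y)); rewrite -wedgeDl !addr0. Qed.

Lemma wedge0r x : wedge x 0 = 0.
Proof. by apply: (addrI (wedge x 0)); rewrite -wedgeDr !addr0. Qed.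

Lemma wedgeNl x y : wedge (- x) y = - wedge x y.
Proof. by apply/eqP; rewrite -addr_eq0 -wedgeDl addNr wedge0l. Qed.

Lemma wedgeNr x y : wedge x (- y) = - wedge x y.
Proof. by apply/eqP; rewrite -addr_eq0 -wedgeDr addNr wedge0r. Qed.
End Wedge.

(* F^* is written additively, so that it is a zmodType: x + y is the product
   in F and 0 is 1. *)
Section Units.
Variable F : fieldType.

Record funits : Type := FUnit { fuval : F; _ : fuval != 0 }.
HB.instance Definition _ := [isSub for fuval].
HB.instance Definition _ := [Choice of funits by <:].

Implicit Types x y z : funits.

Definition fu_one : funits := FUnit (oner_neq0 F).
Definition fu_mul x y : funits := FUnit (mulf_neq0 (valP x) (valP y)).
Fact fu_inv_subproof x : (val x)^-1 != 0.
Proof. by rewrite invr_eq0 (valP x). Qed.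
Definition fu_inv x : funits := FUnit (fu_inv_subproof x).

Fact fu_mulA : associative fu_mul.
Proof. by move=> x y z; apply: val_inj; rewrite /= mulrA. Qed.
Fact fu_mulC : commutative fu_mul.
Proof. by move=> x y; apply: val_inj; rewrite /= mulrC. Qed.
Fact fu_mul1 : left_id fu_one fu_mul.
Proof. by move=> x; apply: val_inj; rewrite /= mul1r. Qed.
Fact fu_mulV : left_inverse fu_one fu_inv fu_mul.
Proof. by move=> x; apply: val_inj; rewrite /= mulVf // (valP x). Qed.

HB.instance Definition _ :=
  GRing.isZmodule.Build funits fu_mulA fu_mulC fu_mul1 fu_mulV.

Lemma val_fuD x y : val (x + y) = val x * val y. Proof. by []. Qed.
Lemma val_fuN x : val (- x) = (val x)^-1. Proof. by []. Qed.
End Units.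

Section Bloch.
Variable F : fieldType.

Record punct : Type := Punct { pval : F; _ : (pval != 0) && (pval != 1) }.
HB.instance Definition _ := [isSub for pval].
HB.instance Definition _ := [Choice of punct by <:].
Implicit Types x y z u v w : punct.

(* The elements u, v, w exist and are unique for any x != y. *)
Definition five_term (r : {freeg punct / int}) : Prop :=
  exists x y u v w,
    [/\ x != y,
        val u = val y / val x,
        val v = (1 - (val x)^-1) / (1 - (val y)^-1),
        val w = (1 - val x) / (1 - val y)
      & r = << x >> - << y >> + << u >> - << v >> + << w >>].

Definition preBloch : Type := zquot five_term.
HB.instance Definition _ := GRing.Zmodule.on preBloch.

Definition brk z : preBloch := zpi five_term << z >>.

Lemma punct_neq0 z : val z != 0.
Proof. by case/andP: (valP z). Qed.

Lemma punct_compl_neq0 z : 1 - val z != 0.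
Proof. by rewrite subr_eq0 eq_sym; case/andP: (valP z). Qed.

Definition delta_gen z : wedge2 (funits F) :=
  wedge (FUnit (punct_neq0 z)) (FUnit (punct_compl_neq0 z)).

Lemma five_term_exists x y : x != y ->
  exists u v w,
    [/\ val u = val y / val x,
        val v = (1 - (val x)^-1) / (1 - (val y)^-1)
      & val w = (1 - val x) / (1 - val y)].
Proof.
rewrite -(inj_eq val_inj); have := valP x; have := valP y.
move: (val x) (val y) => {}x {}y /= /andP[y0 y1] /andP[x0 x1] xy.
have X1 : 1 - x != 0 by rewrite subr_eq0 eq_sym.
have Y1 : 1 - y != 0 by rewrite subr_eq0 eq_sym.
have XV : 1 - x^-1 != 0 by rewrite subr_eq0 eq_sym invr_eq1.
have YV : 1 - y^-1 != 0 by rewrite subr_eq0 eq_sym invr_eq1.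
have neq1 (a b : F) : b != 0 -> a != b -> a / b != 1.
  by move=> b0; apply: contraNN => /eqP/divr1_eq ->.
have Hu : (y / x != 0) && (y / x != 1).
  by rewrite mulf_neq0 ?invr_neq0 // neq1 // eq_sym.
have Hv : ((1 - x^-1) / (1 - y^-1) != 0) && ((1 - x^-1) / (1 - y^-1) != 1).
  rewrite mulf_neq0 ?invr_neq0 // neq1 //.
  by rewrite (inj_eq (addrI _)) eqr_opp (inj_eq invr_inj).
have Hw : ((1 - x) / (1 - y) != 0) && ((1 - x) / (1 - y) != 1).
  rewrite mulf_neq0 ?invr_neq0 // neq1 //.
  by rewrite (inj_eq (addrI _)) eqr_opp.
by exists (Punct Hu), (Punct Hv), (Punct Hw).
Qed.

Lemma delta_five_term r : five_term r -> fgext delta_gen r = 0.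
Proof.
case=> [x [y [u [v [w [xy Eu Ev Ew ->]]]]]].
rewrite raddfD raddfB raddfD raddfB /= !fgextU /delta_gen.
set a : funits F := FUnit (punct_neq0 x); set b : funits F := FUnit (punct_compl_neq0 x).
set c : funits F := FUnit (punct_neq0 y); set d : funits F := FUnit (punct_compl_neq0 y).
have e0 : val x - val y != 0 by rewrite subr_eq0 (inj_eq val_inj).
pose e : funits F := FUnit e0.
have x0 := punct_neq0 x; have y0 := punct_neq0 y.
have x1 := punct_compl_neq0 x; have y1 := punct_compl_neq0 y.
have y2 : val y - 1 != 0 by rewrite -opprB oppr_eq0.
have -> : FUnit (punct_neq0 u) = c - a by apply: val_inj; rewrite /= Eu.
have -> : FUnit (punct_compl_neq0 u) = e - a.
  apply: val_inj; change (1 - val u = (val x - val y) / val x).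
  by rewrite Eu; field.
have -> : FUnit (punct_neq0 v) = (b + c) - (a + d).
  apply: val_inj.
  change (val v = (1 - val x) * val y / (val x * (1 - val y))).
  by rewrite Ev; field; rewrite ?x0 ?y0 ?y1 ?y2.
have -> : FUnit (punct_compl_neq0 v) = e - (a + d).
  apply: val_inj.
  change (1 - val v = (val x - val y) / (val x * (1 - val y))).
  by rewrite Ev; field; rewrite ?x0 ?y0 ?y1 ?y2.
have -> : FUnit (punct_neq0 w) = b - d by apply: val_inj; rewrite /= Ew.
have -> : FUnit (punct_compl_neq0 w) = e - d.
  apply: val_inj; change (1 - val w = (val x - val y) / (1 - val y)).
  by rewrite Ew; field.
rewrite !(opprD, wedgeDl, wedgeDr, wedgeNl, wedgeNr, opprK).
rewrite (wedgeC a b) (wedgeC a c) (wedgeC a d) !opprK !addrA.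
rewrite (ACl ((1*8)*(12*2)*(3*10)*(4*11)*(13*5)*(6*15)*(19*7)*(9*20)*(14*21)
              *(17*16)*(22*18)))%AC /=.
by rewrite !subrr !addr0.
Qed.

Definition delta : preBloch -> wedge2 (funits F) := zlift delta_five_term.
HB.instance Definition _ := GRing.isZmodMorphism.Build preBloch
  (wedge2 (funits F)) delta (zlift_is_additive delta_five_term).

Lemma delta0 : delta 0 = 0. Proof. exact: raddf0. Qed.

Lemma deltaB p q : delta (p - q) = delta p - delta q.
Proof. exact: raddfB. Qed.

Lemma delta_brk z : delta (brk z) = delta_gen z.
Proof. by rewrite /delta /brk zliftE /= fgextU. Qed.

Definition bloch : {pred preBloch} := fun p => delta p == 0.

Lemma blochE p : (p \in bloch) = (delta p == 0).
Proof. by []. Qed.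

Fact bloch_closed : zmod_closed bloch.
Proof.
split=> [|x y]; rewrite !blochE; first by rewrite delta0.
by move=> /eqP dx /eqP dy; rewrite deltaB dx dy subr0.
Qed.
HB.instance Definition _ := GRing.isZmodClosed.Build preBloch bloch bloch_closed.

Record Bloch : Type := MkBloch { bval : preBloch; _ : bval \in bloch }.
HB.instance Definition _ := [isSub for bval].
HB.instance Definition _ := [Choice of Bloch by <:].
HB.instance Definition _ := [SubChoice_isSubZmodule of Bloch by <:].

Fact bval_is_additive : zmod_morphism bval. Proof. by []. Qed.
HB.instance Definition _ :=
  GRing.isZmodMorphism.Build Bloch preBloch bval bval_is_additive.
End Bloch.
Arguments bloch F : clear implicits.

Definition has_order (V : zmodType) (v : V) (n : nat) : Prop :=
  [/\ (0 < n)%N, v *+ n = 0 & forall m, (0 < m < n)%N -> v *+ m <> 0].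

Section Generated.
Variables (L : fieldType) (z : L).

(* The smallest subfield of L containing z. Every divring_closed S contains
   the prime field, so for L of characteristic 0 this is Q(z). *)
Definition gen_subfield : {pred L} :=
  fun x => `[< forall S : {pred L}, divring_closed S -> z \in S -> x \in S >].

Fact gen_subfield_closed : divring_closed gen_subfield.
Proof.
split=> [|x y /asboolP xS /asboolP yS|x y /asboolP xS /asboolP yS];
  apply/asboolP => S cS zS; case: (cS) => S1 SB SD //.
- by apply: SB; [apply: xS | apply: yS].
- by apply: SD; [apply: xS | apply: yS].
Qed.
HB.instance Definition _ :=
  GRing.isDivringClosed.Build L gen_subfield gen_subfield_closed.

Lemma gen_subfield_gen : z \in gen_subfield.
Proof. by apply/asboolP. Qed.

Record genField : Type := GenField { gval : L; _ : gval \in gen_subfield }.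
HB.instance Definition _ := [isSub for gval].
HB.instance Definition _ := [Choice of genField by <:].
HB.instance Definition _ := [SubChoice_isSubComUnitRing of genField by <:].
HB.instance Definition _ := [SubComUnitRing_isSubIntegralDomain of genField by <:].
HB.instance Definition _ := [SubIntegralDomain_isSubField of genField by <:].
End Generated.

Section Whitehead.
Variable R : realType.
Local Open Scope complex_scope.

Definition sqrtm15 : R[i] := 0 +i* Num.sqrt 15.

Lemma sqrtm15_sqr : sqrtm15 ^+ 2 = - 15.
Proof.
have -> : (15 : R[i]) = (15 : R)%:C by rewrite rmorph_nat.
apply/eqP; rewrite eq_complex /= !mul0r mulr0 addr0 sub0r oppr0 eqxx andbT.
by rewrite -expr2 sqr_sqrtr ?ler0n.
Qed.

Definition K15 : fieldType := genField sqrtm15.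

Lemma mem_K15 (p q : rat) :
  (ratr p : R) +i* (ratr q * Num.sqrt 15) \in gen_subfield sqrtm15.
Proof.
have -> : (ratr p : R) +i* (ratr q * Num.sqrt 15) = ratr p + ratr q * sqrtm15.
  rewrite -!(fmorph_rat (real_complex R)); apply/eqP.
  by rewrite eq_complex /= !mul0r !mulr0 subr0 !addr0 add0r !eqxx.
apply: rpredD; first exact: rpred_rat.
by apply: rpredM; [exact: rpred_rat | exact: gen_subfield_gen].
Qed.

Lemma conj_K15 (z : R[i]) :
  z \in gen_subfield sqrtm15 -> z^* \in gen_subfield sqrtm15.
Proof.
move=> /asboolP /(_ [pred x : R[i] | x^* \in gen_subfield sqrtm15]); apply.
  split=> [|x y|x y]; rewrite !inE.
  - by rewrite rmorph1; exact: rpred1.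
  - by rewrite rmorphB => xK yK; exact: rpredB.
  - by rewrite fmorph_div => xK yK; exact: rpred_div.
rewrite inE (_ : sqrtm15^* = - sqrtm15).
  by rewrite rpredN; exact: gen_subfield_gen.
by apply/eqP; rewrite eq_complex /= oppr0 !eqxx.
Qed.

Fact point_subproof (z : R[i]) (zK : z \in gen_subfield sqrtm15) :
  (z != 0) && (z != 1) -> ((GenField zK : K15) != 0) && ((GenField zK : K15) != 1).
Proof. by rewrite -!(inj_eq val_inj). Qed.

Definition point (z : R[i]) (zK : z \in gen_subfield sqrtm15)
    (z01 : (z != 0) && (z != 1)) : punct K15 :=
  Punct (point_subproof zK z01).

Definition cval (x : punct K15) : R[i] := gval (pval x : genField sqrtm15).

Lemma pointK z zK z01 : cval (@point z zK z01) = z. Proof. by []. Qed.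

Fact conj_subproof (x : punct K15) : ((cval x)^* != 0) && ((cval x)^* != 1).
Proof.
have := valP x; rewrite -!(inj_eq val_inj) -/(cval x) /= => /andP[x0 x1].
by rewrite conjc_eq0 x0 -(inj_eq (can_inj (@conjcK R))) conjcK rmorph1.
Qed.

Definition conjK (x : punct K15) : punct K15 :=
  point (conj_K15 (valP (pval x : genField sqrtm15))) (conj_subproof x).

Lemma conjKE x : cval (conjK x) = (cval x)^*. Proof. by []. Qed.

Definition cA01 : R[i] := (- (1 / 8)) +i* (Num.sqrt 15 / 8).
Definition cA23 : R[i] := (- (3 / 4)) +i* (Num.sqrt 15 / 4).
Definition cA32 : R[i] := (1 / 2) +i* (- (Num.sqrt 15 / 6)).

Fact sqrt15_neq0 : Num.sqrt 15 != 0 :> R.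
Proof. by rewrite sqrtr_eq0 -ltNge ltr0n. Qed.

Fact im_neq01 (a b : R) : b != 0 -> (a +i* b != 0) && (a +i* b != 1).
Proof. by move=> b0; rewrite !eq_complex /= !negb_and b0 !orbT. Qed.

Fact cA01_K : cA01 \in gen_subfield sqrtm15.
Proof.
have := mem_K15 (- (1 / 8)) (1 / 8).
by rewrite rmorphN !fmorph_div rmorph1 rmorph_nat /cA01 [_ * Num.sqrt _]mulrC div1r.
Qed.
Fact cA01_01 : (cA01 != 0) && (cA01 != 1).
Proof. by apply: im_neq01; rewrite mulf_neq0 ?sqrt15_neq0 ?invr_neq0 ?pnatr_eq0. Qed.

Fact cA23_K : cA23 \in gen_subfield sqrtm15.
Proof.
have := mem_K15 (- (3 / 4)) (1 / 4).
by rewrite rmorphN !fmorph_div rmorph1 !rmorph_nat /cA23 [_ * Num.sqrt _]mulrC div1r.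
Qed.
Fact cA23_01 : (cA23 != 0) && (cA23 != 1).
Proof. by apply: im_neq01; rewrite mulf_neq0 ?sqrt15_neq0 ?invr_neq0 ?pnatr_eq0. Qed.

Fact cA32_K : cA32 \in gen_subfield sqrtm15.
Proof.
have := mem_K15 (1 / 2) (- (1 / 6)).
rewrite rmorphN !fmorph_div rmorph1 !rmorph_nat /cA32 mulNr.
by rewrite [_ * Num.sqrt _]mulrC !div1r.
Qed.
Fact cA32_01 : (cA32 != 0) && (cA32 != 1).
Proof.
apply: im_neq01.
by rewrite oppr_eq0 mulf_neq0 ?sqrt15_neq0 ?invr_neq0 ?pnatr_eq0.
Qed.

Fact m2_K : - 2 \in gen_subfield sqrtm15.
Proof. by rewrite rpredN rpred_nat. Qed.
Fact m2_01 : (- 2 != 0 :> R[i]) && (- 2 != 1 :> R[i]).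
Proof.
rewrite oppr_eq0 pnatr_eq0 /= -subr_eq0 -opprD oppr_eq0.
by rewrite -(natrD _ 2 1) pnatr_eq0.
Qed.

Fact half_K : 1 / 2 \in gen_subfield sqrtm15.
Proof. by rewrite rpred_div ?rpred1 ?rpred_nat. Qed.
Fact half_01 : (1 / 2 != 0 :> R[i]) && (1 / 2 != 1 :> R[i]).
Proof.
rewrite div1r invr_eq0 pnatr_eq0 /= invr_eq1 -subr_eq0.
by rewrite -(natrB _ (isT : 1 <= 2)%N) pnatr_eq0.
Qed.

Definition A01 := point cA01_K cA01_01.
Definition A10 := point m2_K m2_01.
Definition A23 := point cA23_K cA23_01.
Definition A32 := point cA32_K cA32_01.
Definition ptHalf := point half_K half_01.

Definition betaW : preBloch K15 :=
  brk A10 *+ 4 +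
  (brk A01 + brk (conjK A01) + brk A23 + brk (conjK A23)
   + brk A32 + brk (conjK A32)) *+ 2.

Definition cr_class (z01 z10 z23 z32 : punct K15) : preBloch K15 :=
  brk z01 + brk z10 + brk z23 + brk z32.

(* The four CR tetrahedra A, B, C, D of the triangulation; all occurrences of
   the cross-ratio -2 are written A10. *)
Lemma betaW_tetrahedra :
  betaW = cr_class A01 A10 A23 A32
        + cr_class A10 (conjK A01) (conjK A32) (conjK A23)
        + cr_class (conjK A01) A10 (conjK A23) (conjK A32)
        + cr_class A10 A01 A32 A23.
Proof.
rewrite /betaW /cr_class; move: (brk A01) (brk A10) (brk A23) (brk A32).
move: (brk (conjK A01)) (brk (conjK A23)) (brk (conjK A32)).
move=> u v w a b c d; rewrite !mulrnDl !mulrS !mulr0n !addr0 !addrA.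
by rewrite [RHS](ACl (2*5*10*13*1*14*6*9*3*16*8*11*4*15*7*12))%AC.
Qed.
End Whitehead.

(* Main.v *)
Require Import Defs.
From HB Require Import structures.
From mathcomp Require Import all_boot all_order all_algebra reals.
From mathcomp Require Import ring lra zify boolp.
From mathcomp.real_closed Require Import complex.
From mathcomp.multinomials Require Import freeg.

(* Write d(x) = 2[x] and c = [x] + [1 - x], which is independent of x.  Up to
   multiples of c, d is invariant or changes sign along the orbit of x under
   x -> 1/x and x -> 1 - x, and 6c = 0.  Three five-term relations, those of
   (-2, (-1 - sqrt(-15))/2), of (1/2, 3/4 + sqrt(-15)/12) and of its conjugate,
   then give beta(W) = 2c = 4[1/2], which is killed by 3 and by delta because
   c = 2[1/2].

   That 2c is nonzero is seen at a prime of Q(sqrt(-15)) above 2, which has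
   residue field F_2: if v is the corresponding valuation, [x] |-> sgn(v(x))
   satisfies the five-term relation modulo 3, and sends 4[1/2] to -4. *)

Set Implicit Arguments.
Unset Strict Implicit.
Unset Printing Implicit Defensive.

Import Order.TTheory GRing.Theory Num.Theory.
Local Open Scope ring_scope.

(** * Deciding identities in abelian groups *)

Section SquareZero.
Variable V : zmodType.

(* The square-zero extension Z + V: the additive injection of V into this
   commutative ring lets the tactic [ring] decide identities in V. *)
Definition sqzero : Type := (int * V)%type.
HB.instance Definition _ := GRing.Zmodule.on sqzero.

Definition sqzero_mul (a b : sqzero) : sqzero :=
  (a.1 * b.1, b.2 *~ a.1 + a.2 *~ b.1).

Fact sqzero_mulA : associative sqzero_mul.
Proof.
move=> [a u] [b v] [c w]; rewrite /sqzero_mul /= mulrA; congr pair.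
rewrite !mulrzDl -!mulrzA addrA [b * a]mulrC [c * a]mulrC.
by congr (_ + _ + _); rewrite mulrC.
Qed.

Fact sqzero_mulC : commutative sqzero_mul.
Proof. by move=> a b; rewrite /sqzero_mul mulrC addrC. Qed.

Fact sqzero_mul1 : left_id ((1, 0) : sqzero) sqzero_mul.
Proof. by move=> [a u]; rewrite /sqzero_mul /= mul1r mulr1z mul0rz addr0. Qed.

Fact sqzero_mulDl : left_distributive sqzero_mul +%R.
Proof.
move=> [a u] [b v] [c w]; rewrite /sqzero_mul /= mulrDl; congr pair.
by rewrite mulrzDr mulrzDl addrACA.
Qed.

Fact sqzero_1neq0 : (1, 0) != 0 :> sqzero. Proof. by []. Qed.

HB.instance Definition _ := GRing.Zmodule_isComNzRing.Build sqzero
  sqzero_mulA sqzero_mulC sqzero_mul1 sqzero_mulDl sqzero_1neq0.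

Definition sqzero_inj (v : V) : sqzero := (0, v).

Fact sqzero_inj_is_additive : zmod_morphism sqzero_inj.
Proof. by move=> u v; congr pair. Qed.
HB.instance Definition _ :=
  GRing.isZmodMorphism.Build V sqzero sqzero_inj sqzero_inj_is_additive.

Lemma sqzero_injP : injective sqzero_inj. Proof. by move=> u v []. Qed.
End SquareZero.

Ltac zmod_ring := apply: sqzero_injP; ring.

(** * Consequences of the five-term relation *)

Section TotalBracket.
Variable F : fieldType.
Implicit Types x y z : F.

(* Junk value 0 at the two points [0] and [1] outside of [punct F]. *)
Definition tbrk x : preBloch F := if insub x is Some z then brk z else 0.

Lemma tbrk_val (z : punct F) : tbrk (val z) = brk z.
Proof. by rewrite /tbrk valK. Qed.

Lemma tbrk_five_term x y : x != 0 -> x != 1 -> y != 0 -> y != 1 -> x != y ->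
  tbrk x - tbrk y + tbrk (y / x) - tbrk ((1 - x^-1) / (1 - y^-1))
    + tbrk ((1 - x) / (1 - y)) = 0.
Proof.
move=> x0 x1 y0 y1 xy.
have hx : (x != 0) && (x != 1) by rewrite x0.
have hy : (y != 0) && (y != 1) by rewrite y0.
have hxy : Punct hx != Punct hy by rewrite -(inj_eq val_inj).
have [u [v [w [/= Eu Ev Ew]]]] := five_term_exists hxy.
rewrite -Eu -Ev -Ew -[x]/(val (Punct hx)) -[y]/(val (Punct hy)) !tbrk_val.
rewrite /brk -raddfB -raddfD -raddfB -raddfD.
by apply: zpi_rel; exists (Punct hx), (Punct hy), u, v, w.
Qed.

Lemma sub1_neq0 z : z != 1 -> 1 - z != 0.
Proof. by rewrite subr_eq0 eq_sym. Qed.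

Lemma sub1_neq1 z : z != 0 -> 1 - z != 1.
Proof. by rewrite -(inj_eq (subrI 1)) subr0. Qed.

(* The five-term relations of [(x, y)] and [(1 - y, 1 - x)] differ only in
   their first two terms. *)
Lemma tbrk_compl_const x y : x != 0 -> x != 1 -> y != 0 -> y != 1 ->
  tbrk x + tbrk (1 - x) = tbrk y + tbrk (1 - y).
Proof.
move=> x0 x1 y0 y1; have [->//|xy] := eqVneq x y.
have X1 := sub1_neq0 x1; have Y1 := sub1_neq0 y1.
have xy' : 1 - y != 1 - x by rewrite (inj_eq (addrI _)) eqr_opp eq_sym.
have H1 := tbrk_five_term x0 x1 y0 y1 xy.
have := tbrk_five_term Y1 (sub1_neq1 y0) X1 (sub1_neq1 x0) xy'.
have -> : (1 - (1 - y)) / (1 - (1 - x)) = y / x by rewrite !subKr.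
have -> : (1 - (1 - y)^-1) / (1 - (1 - x)^-1) = (1 - x^-1) / (1 - y^-1).
  have y2 : y - 1 != 0 by rewrite subr_eq0.
  have x2 : 1 - x - 1 != 0 by rewrite addrAC subrr sub0r oppr_eq0.
  by field; rewrite y0 y2 x0 X1 x2.
move=> H2; apply/eqP; rewrite -subr_eq0; apply/eqP.
by rewrite -[RHS]subr0 -{1}H1 -H2; zmod_ring.
Qed.

Lemma tbrk_half_compl x : 2 != 0 :> F -> x != 0 -> x != 1 ->
  tbrk x + tbrk (1 - x) = tbrk 2^-1 *+ 2.
Proof.
move=> n2 x0 x1; rewrite (@tbrk_compl_const x 2^-1) ?invr_eq0 //.
  by rewrite mulr2n; congr (_ + tbrk _); field.
by rewrite invr_eq1 -subr_eq0 (_ : 2 - 1 = 1) ?oner_eq0 //; ring.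
Qed.

Definition sym_brk x := tbrk x + tbrk x^-1.

Lemma sym_brkV x : sym_brk x^-1 = sym_brk x.
Proof. by rewrite /sym_brk invrK addrC. Qed.

(* Add the five-term relations of [(x, y)] and [(y, x)], where [x] and [y] are
   chosen such that [y / x = u] and [(1 - x) / (1 - y) = w]. *)
Lemma sym_brkM u w : u != 0 -> u != 1 -> w != 0 -> w != 1 -> u * w != 1 ->
  sym_brk (u * w) = sym_brk u + sym_brk w.
Proof.
move=> u0 u1 w0 w1 uw1.
have U1 := sub1_neq0 u1; have W1 := sub1_neq0 w1; have D := sub1_neq0 uw1.
pose x := (1 - w) / (1 - u * w); pose y := u * x.
have x0 : x != 0 by rewrite mulf_neq0 ?invr_neq0.
have y0 : y != 0 by rewrite mulf_neq0.
have ex : 1 - x = w * (1 - u) / (1 - u * w) by rewrite /x; field.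
have ey : 1 - y = (1 - u) / (1 - u * w) by rewrite /y /x; field.
have X1 : 1 - x != 0 by rewrite ex !mulf_neq0 ?invr_neq0.
have Y1 : 1 - y != 0 by rewrite ey mulf_neq0 ?invr_neq0.
have x1 : x != 1 by rewrite -(inj_eq (subrI 1)) subrr.
have y1 : y != 1 by rewrite -(inj_eq (subrI 1)) subrr.
have X2 : x - 1 != 0 by rewrite subr_eq0.
have Y2 : y - 1 != 0 by rewrite subr_eq0.
have xy : x != y.
  by rewrite -subr_eq0 /y -{1}[x]mul1r -mulrBl mulf_neq0.
have yx : y != x by rewrite eq_sym.
have eu : y / x = u by rewrite /y mulfK.
have ew : (1 - x) / (1 - y) = w.
  by rewrite ex ey invf_div mulrA mulfVK ?mulfK.
have ev : (1 - x^-1) / (1 - y^-1) = u * w.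
  by rewrite -ew -eu; field; rewrite ?x0 ?y0 ?X1 ?Y1 ?X2 ?Y2.
have H1 := tbrk_five_term x0 x1 y0 y1 xy.
have := tbrk_five_term y0 y1 x0 x1 yx.
rewrite eu ew ev in H1.
rewrite -invf_div eu -(invf_div (1 - x)) ew -(invf_div (1 - x^-1)) ev => H2.
apply/esym/eqP; rewrite -subr_eq0; apply/eqP.
by rewrite -[RHS]addr0 -{1}H1 -H2 /sym_brk; zmod_ring.
Qed.

(** Apply [sym_brkM] to x * x, and then to x^2 * x^-1 = x. As [sym_brk] agrees at x and x^-1, the
    second relation leaves [sym_brk (x ^+ 2)] = 0. *)
Lemma sym_brk_torsion x : x != 0 -> x ^+ 2 != 1 -> sym_brk x *+ 2 = 0.
Proof.
move=> x0 xx1; have x1 : x != 1 by apply: contra_neq xx1 => ->; rewrite expr1n.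
have xx0 : x ^+ 2 != 0 by rewrite expf_neq0.
have -> : sym_brk x *+ 2 = sym_brk (x ^+ 2).
  by rewrite expr2 sym_brkM.
apply: (addIr (sym_brk x^-1)); rewrite add0r -sym_brkM ?invr_eq0 ?invr_eq1 //.
  by rewrite sym_brkV expr2 mulfK.
by rewrite expr2 mulfK.
Qed.

Lemma tbrkV2 x : x != 0 -> x ^+ 2 != 1 -> tbrk x^-1 *+ 2 = - (tbrk x *+ 2).
Proof.
move=> x0 xx1; apply/eqP; rewrite -addr_eq0 -mulrnDl addrC.
by apply/eqP/sym_brk_torsion.
Qed.

(** Add the constant c = 2[1/2] as computed at x, x^-1 and (1 - x)^-1. After doubling, the six
    brackets cancel in inverse pairs, so 6c = 0. The point x is only a witness, needed to keep
    [tbrkV2] applicable. *)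
Lemma tbrk_half_torsion x : 2 != 0 :> F -> x != 0 -> x ^+ 2 != 1 ->
  (1 - x) ^+ 2 != 1 -> (1 - x^-1) ^+ 2 != 1 -> tbrk 2^-1 *+ 12 = 0.
Proof.
move=> n2 x0 xx1 yy1 zz1.
have x1 : x != 1 by apply: contra_neq xx1 => ->; rewrite expr1n.
have y0 := sub1_neq0 x1; have y1 := sub1_neq1 x0.
have xV0 : x^-1 != 0 by rewrite invr_eq0.
have xV1 : x^-1 != 1 by rewrite invr_eq1.
have z0 := sub1_neq0 xV1.
have yV0 : (1 - x)^-1 != 0 by rewrite invr_eq0.
have yV1 : (1 - x)^-1 != 1 by rewrite invr_eq1.
have e : 1 - (1 - x)^-1 = (1 - x^-1)^-1.
  have x2 : x - 1 != 0 by rewrite subr_eq0.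
  by field; rewrite x0 y0 x2.
have H1 := tbrk_half_compl n2 x0 x1.
have H2 := tbrk_half_compl n2 xV0 xV1.
have := tbrk_half_compl n2 yV0 yV1; rewrite e => H3.
have V1 := tbrkV2 x0 xx1; have V2 := tbrkV2 y0 yy1; have V3 := tbrkV2 z0 zz1.
move/(congr1 (fun t => t *+ 2)): H1; move/(congr1 (fun t => t *+ 2)): H2.
move/(congr1 (fun t => t *+ 2)): H3; rewrite !mulrnDl V1 V2 V3.
move: (tbrk 2^-1) (tbrk x) (tbrk (1 - x)) (tbrk (1 - x^-1)) => h a b c.
move=> H3 H2 H1.
transitivity ((h *+ 2 + h *+ 2) + (h *+ 2 + h *+ 2) + (h *+ 2 + h *+ 2)).
  by zmod_ring.
by rewrite -{1}H1 -{1}H2 -H3; zmod_ring.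
Qed.
End TotalBracket.

(** * Explicit five-term relations over Q(sqrt(-15)) *)

Section QuadraticPoints.
Variables (F : fieldType) (iota : {rmorphism rat -> F}) (s : F).
Hypothesis s2 : s ^+ 2 = - 15.
Implicit Types x y u v w : rat * rat.

(* Elements of Q(sqrt -15) are handled through their rational coordinates, on
   which side conditions are decided by computation. *)
Definition qpt x : F := iota x.1 + iota x.2 * s.

Definition qadd x y : rat * rat := (x.1 + y.1, x.2 + y.2).
Definition qopp x : rat * rat := (- x.1, - x.2).
Definition qmul x y : rat * rat :=
  (x.1 * y.1 - 15 * (x.2 * y.2), x.1 * y.2 + x.2 * y.1).
Definition q1 : rat * rat := (1, 0).

Lemma qpt1 : qpt q1 = 1.
Proof. by rewrite /qpt rmorph1 rmorph0 mul0r addr0. Qed.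

Lemma qptD x y : qpt (qadd x y) = qpt x + qpt y.
Proof. by rewrite /qpt /= !rmorphD; ring. Qed.

Lemma qptN x : qpt (qopp x) = - qpt x.
Proof. by rewrite /qpt /= !rmorphN; ring. Qed.

Lemma qptM x y : qpt (qmul x y) = qpt x * qpt y.
Proof.
by rewrite /qpt /= rmorphB rmorphD !rmorphM (rmorph_nat _ 15); ring: s2.
Qed.

(** Multiplying by the conjugate gives the norm p^2 + 15 q^2, a positive definite form over Q. *)
Lemma qpt_eq0 x : qpt x = 0 -> x = (0, 0).
Proof.
move=> x0; have : qpt (qmul x (x.1, - x.2)) = 0 by rewrite qptM x0 mul0r.
rewrite /qmul /qpt /= (_ : _ + x.2 * x.1 = 0); last by ring.
rewrite rmorph0 mul0r addr0 => /eqP; rewrite fmorph_eq0 => /eqP e.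
by case: x e {x0} => p q /= e; congr pair; nra.
Qed.

Lemma qpt_inj : injective qpt.
Proof.
move=> x y xy; have := @qpt_eq0 (qadd x (qopp y)).
rewrite qptD qptN xy subrr => /(_ erefl) [/eqP e1 /eqP e2].
move: e1 e2; rewrite !subr_eq0; case: x y {xy} => [a b] [c d] /=.
by move=> /eqP-> /eqP->.
Qed.

Lemma qpt_neq0 x : x != (0, 0) -> qpt x != 0.
Proof. by apply: contraNneq => /qpt_eq0 ->. Qed.

Lemma qpt_neq1 x : x != q1 -> qpt x != 1.
Proof. by rewrite -qpt1 (inj_eq qpt_inj). Qed.

Definition qtbrk x : preBloch F := tbrk (qpt x).

(** The equations defining u, v, w are stated without denominators, so that for explicit coordinates
    both hypotheses evaluate to [true] and [isT] proves them. *)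
Lemma qtbrk_five_term x y u v w :
  [&& x != (0, 0), x != q1, y != (0, 0), y != q1 & x != y] ->
  [&& qmul u x == y,
      qmul v (qmul x (qadd y (qopp q1))) == qmul (qadd x (qopp q1)) y
    & qmul w (qadd q1 (qopp y)) == qadd q1 (qopp x)] ->
  qtbrk x - qtbrk y + qtbrk u - qtbrk v + qtbrk w = 0.
Proof.
move=> /and5P[x0 x1 y0 y1 xy] /and3P[/eqP eu /eqP ev /eqP ew].
move: (qpt_neq0 x0) (qpt_neq1 x1) (qpt_neq0 y0) (qpt_neq1 y1).
move=> {}x0 {}x1 {}y0 {}y1.
rewrite -(inj_eq qpt_inj) in xy.
have Y1 := sub1_neq0 y1; have Y2 : qpt y - 1 != 0 by rewrite subr_eq0.
rewrite -[RHS](tbrk_five_term x0 x1 y0 y1 xy) /qtbrk.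
congr (_ - _ + tbrk _ - tbrk _ + tbrk _).
- by rewrite -eu qptM mulfK.
- have := congr1 qpt ev; rewrite !(qptM, qptD, qptN, qpt1) => e.
  have -> : qpt v = (qpt x - 1) * qpt y / (qpt x * (qpt y - 1)).
    by rewrite -e mulfK ?mulf_neq0.
  by field; rewrite ?x0 ?y0 ?Y1 ?Y2.
- have := congr1 qpt ew; rewrite !(qptM, qptD, qptN, qpt1) => <-.
  by rewrite mulfK.
Qed.

Lemma qtbrkV2 x y : qmul y x == q1 -> qmul x x != q1 ->
  qtbrk y *+ 2 = - (qtbrk x *+ 2).
Proof.
move=> /eqP/(congr1 qpt); rewrite qptM qpt1 => yx /qpt_neq1; rewrite qptM => xx.
have x0 : qpt x != 0.
  by apply/eqP => x0; move/eqP: yx; rewrite x0 mulr0 eq_sym oner_eq0.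
rewrite -tbrkV2 //; congr (tbrk _ *+ _).
by rewrite -[LHS](mulfK x0) yx mul1r.
Qed.

Lemma qpt_nat n : qpt (n%:R, 0) = n%:R.
Proof. by rewrite /qpt /= rmorph_nat rmorph0 mul0r addr0. Qed.

Lemma two_neq0 : 2 != 0 :> F.
Proof. by rewrite -qpt_nat; apply: qpt_neq0. Qed.

Lemma qpt_half : qpt (1 / 2, 0) = 2^-1.
Proof. by rewrite /qpt /= rmorph0 mul0r addr0 div1r fmorphV rmorph_nat. Qed.

Lemma qtbrk_compl x y : x != (0, 0) -> x != q1 -> qadd x y == q1 ->
  qtbrk y = qtbrk (1 / 2, 0) *+ 2 - qtbrk x.
Proof.
move=> /qpt_neq0 x0 /qpt_neq1 x1 /eqP/(congr1 qpt); rewrite qptD qpt1 => xy.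
rewrite /qtbrk qpt_half -(tbrk_half_compl two_neq0 x0 x1) -xy.
by rewrite [_ + qpt y]addrC addrK [RHS]addrC addKr.
Qed.

Lemma qtbrk_half_torsion : qtbrk (1 / 2, 0) *+ 12 = 0.
Proof.
have e3 : qpt (3, 0) = 3 by exact: (qpt_nat 3).
have e1 : 1 - 3^-1 = qpt (2 / 3, 0) :> F.
  rewrite /qpt /= rmorph0 mul0r addr0 fmorph_div !rmorph_nat; field.
  by rewrite -e3 qpt_neq0.
have e2 : 1 - 3 = qpt (-2, 0) :> F by rewrite -e3 -qpt1 -qptN -qptD; congr qpt.
(* The witness 3 works because 3, 1 - 3 = -2 and 1 - 1/3 = 2/3 all have squares different from 1. *)
rewrite /qtbrk qpt_half (@tbrk_half_torsion _ 3) ?two_neq0 ?e1 ?e2 -?e3 //.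
- by rewrite qpt_neq0.
- by rewrite expr2 -qptM qpt_neq1.
- by rewrite expr2 -qptM qpt_neq1.
- by rewrite expr2 -qptM qpt_neq1.
Qed.

(** Take x = -2 and y = (-1 - s)/2, the inverse of A01 = (-1 + s)/8. Then u + w = 1, and v = 1 -
    conj(A01), so the constants c cancel and [-2] - [1/A01] + [conj(A01)] = 0 remains, to be
    doubled. *)
Lemma qtbrk_minus2 :
  qtbrk (-2, 0) *+ 2 + qtbrk (- (1 / 8), 1 / 8) *+ 2
    + qtbrk (- (1 / 8), - (1 / 8)) *+ 2 = 0.
Proof.
have H := @qtbrk_five_term (-2, 0) (- (1 / 2), - (1 / 2)) (1 / 4, 1 / 4)
  (9 / 8, 1 / 8) (3 / 4, - (1 / 4)) isT isT.
have I := @qtbrkV2 (- (1 / 8), 1 / 8) (- (1 / 2), - (1 / 2)) isT isT.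
have C1 := @qtbrk_compl (- (1 / 8), - (1 / 8)) (9 / 8, 1 / 8) isT isT isT.
have C2 := @qtbrk_compl (1 / 4, 1 / 4) (3 / 4, - (1 / 4)) isT isT isT.
rewrite C1 C2 in H; rewrite -[qtbrk (- (1 / 8), 1 / 8) *+ 2]opprK -I.
by rewrite -[RHS](mul0rn _ 2) -H; zmod_ring.
Qed.

(** Add the five-term relation of (1/2, 3/4 + s/12) to its conjugate and double. Every term is tied
    to A01, A23 or A32 by inversion and z -> 1 - z, except v and its conjugate, which sum to 1 and
    so contribute a multiple of [1/2]. *)
Lemma qtbrk_conj_sums :
  qtbrk (- (3 / 4), 1 / 4) *+ 2 + qtbrk (- (3 / 4), - (1 / 4)) *+ 2 =
  qtbrk (- (1 / 8), 1 / 8) *+ 2 + qtbrk (- (1 / 8), - (1 / 8)) *+ 2.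
Proof.
have H1 := @qtbrk_five_term (1 / 2, 0) (3 / 4, 1 / 12) (3 / 2, 1 / 6)
  (1 / 2, 1 / 2) (3 / 4, 1 / 4) isT isT.
have H2 := @qtbrk_five_term (1 / 2, 0) (3 / 4, - (1 / 12)) (3 / 2, - (1 / 6))
  (1 / 2, - (1 / 2)) (3 / 4, - (1 / 4)) isT isT.
(* The point y is 1/(1 - A01), u is 1 - 1/A23 and w is 1/A32; likewise for the conjugates. *)
have Y1 := @qtbrkV2 (9 / 8, - (1 / 8)) (3 / 4, 1 / 12) isT isT.
have Y2 := @qtbrkV2 (9 / 8, 1 / 8) (3 / 4, - (1 / 12)) isT isT.
have P1 := @qtbrkV2 (- (3 / 4), 1 / 4) (- (1 / 2), - (1 / 6)) isT isT.
have P2 := @qtbrkV2 (- (3 / 4), - (1 / 4)) (- (1 / 2), 1 / 6) isT isT.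
have W1 := @qtbrkV2 (1 / 2, - (1 / 6)) (3 / 4, 1 / 4) isT isT.
have W2 := @qtbrkV2 (1 / 2, 1 / 6) (3 / 4, - (1 / 4)) isT isT.
rewrite (@qtbrk_compl (- (1 / 8), 1 / 8) (9 / 8, - (1 / 8)) isT isT isT) in Y1.
rewrite (@qtbrk_compl (- (1 / 8), - (1 / 8)) (9 / 8, 1 / 8) isT isT isT) in Y2.
rewrite (@qtbrk_compl (1 / 2, - (1 / 6)) (1 / 2, 1 / 6) isT isT isT) in W2.
rewrite (@qtbrk_compl (- (1 / 2), - (1 / 6)) (3 / 2, 1 / 6) isT isT isT) in H1.
rewrite (@qtbrk_compl (- (1 / 2), 1 / 6) (3 / 2, - (1 / 6)) isT isT isT) in H2.
rewrite (@qtbrk_compl (1 / 2, 1 / 2) (1 / 2, - (1 / 2)) isT isT isT) in H2.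
have T := qtbrk_half_torsion; move: Y1 Y2 P1 P2 W1 W2 T H1 H2.
move: (qtbrk (1 / 2, 0)) => h.
move: (qtbrk (3 / 4, 1 / 12)) (qtbrk (3 / 4, - (1 / 12))) => y1 y2.
move: (qtbrk (- (1 / 2), - (1 / 6))) (qtbrk (- (1 / 2), 1 / 6)) => p1 p2.
move: (qtbrk (3 / 4, 1 / 4)) (qtbrk (3 / 4, - (1 / 4))) => w1 w2.
move: (qtbrk (1 / 2, 1 / 2)) (qtbrk (1 / 2, - (1 / 6))) => v t.
move: (qtbrk (- (1 / 8), 1 / 8)) (qtbrk (- (1 / 8), - (1 / 8))) => a1 a2.
move: (qtbrk (- (3 / 4), 1 / 4)) (qtbrk (- (3 / 4), - (1 / 4))) => b1 b2.
move=> Y1 Y2 P1 P2 W1 W2 T H1 H2.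
apply/eqP; rewrite -subr_eq0 -[b1 *+ 2]opprK -[b2 *+ 2]opprK -P1 -P2.
have -> : a1 *+ 2 = y1 *+ 2 + h *+ 4 by rewrite Y1; zmod_ring.
have -> : a2 *+ 2 = y2 *+ 2 + h *+ 4 by rewrite Y2; zmod_ring.
(* A32 and its conjugate sum to 1, so their inverses contribute -2c = -4[1/2]. *)
have E : w1 *+ 2 + w2 *+ 2 + h *+ 4 = 0 by rewrite W1 W2; zmod_ring.
(* The two sides differ by the relations up to 12[1/2], which vanishes by torsion. *)
apply/eqP; transitivity ((h - y1 + (h *+ 2 - p1) - v + w1) *+ 2
  + (h - y2 + (h *+ 2 - p2) - (h *+ 2 - v) + w2) *+ 2
  - (w1 *+ 2 + w2 *+ 2 + h *+ 4) - h *+ 12); first by zmod_ring.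
by rewrite H1 H2 E T mul0rn !subr0 addr0.
Qed.

(** The A32 pair sums to 1 and gives 2c = 4[1/2]. Trading the A23 pair for the A01 pair turns the
    rest into twice the left side of [qtbrk_minus2], hence 0. *)
Lemma whitehead_relation :
  qtbrk (-2, 0) *+ 4
  + (qtbrk (- (1 / 8), 1 / 8) + qtbrk (- (1 / 8), - (1 / 8))
     + qtbrk (- (3 / 4), 1 / 4) + qtbrk (- (3 / 4), - (1 / 4))
     + qtbrk (1 / 2, - (1 / 6)) + qtbrk (1 / 2, 1 / 6)) *+ 2
  = qtbrk (1 / 2, 0) *+ 4.
Proof.
rewrite (@qtbrk_compl (1 / 2, - (1 / 6)) (1 / 2, 1 / 6) isT isT isT).
move: qtbrk_minus2 qtbrk_conj_sums.
move: (qtbrk (1 / 2, 0)) (qtbrk (-2, 0)) (qtbrk (1 / 2, - (1 / 6))) => h m t.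
move: (qtbrk (- (1 / 8), 1 / 8)) (qtbrk (- (1 / 8), - (1 / 8))) => a1 a2.
move: (qtbrk (- (3 / 4), 1 / 4)) (qtbrk (- (3 / 4), - (1 / 4))) => b1 b2 H S.
transitivity (m *+ 4 + (a1 *+ 2 + a2 *+ 2) + (b1 *+ 2 + b2 *+ 2) + h *+ 4).
  by zmod_ring.
rewrite S; transitivity ((m *+ 2 + a1 *+ 2 + a2 *+ 2) *+ 2 + h *+ 4).
  by zmod_ring.
by rewrite H mul0rn add0r.
Qed.
End QuadraticPoints.

(** * The sign of a valuation with residue field F_2 *)

Section ValuationSign.
Variables (F : fieldType) (v : F -> int).
Hypothesis vM : forall x y : F, x != 0 -> y != 0 -> v (x * y) = v x + v y.
Hypothesis v_max : forall x : F, x != 0 -> 0 < v x -> v (1 - x) = 0.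
(* The residue field is F_2. *)
Hypothesis v_unit : forall x : F, x != 0 -> x != 1 -> v x = 0 -> 0 < v (1 - x).

Lemma v_1 : v 1 = 0.
Proof. by apply: (addrI (v 1)); rewrite -vM ?oner_neq0 // mulr1 addr0. Qed.

Lemma v_N1 : v (- 1) = 0.
Proof.
have : v (- 1) + v (- 1) = 0.
  by rewrite -vM ?oppr_eq0 ?oner_neq0 // mulrNN mulr1 v_1.
lia.
Qed.

Lemma vN x : x != 0 -> v (- x) = v x.
Proof. by move=> x0; rewrite -mulN1r vM ?oppr_eq0 ?oner_neq0 // v_N1 add0r. Qed.

Lemma vV x : x != 0 -> v x^-1 = - v x.
Proof.
by move=> x0; apply/eqP; rewrite -addr_eq0 -vM ?invr_eq0 // mulVf // v_1.
Qed.

Lemma v_pole x : x != 0 -> v x < 0 -> v (1 - x) = v x.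
Proof.
move=> x0 vx; have V0 : x^-1 != 0 by rewrite invr_eq0.
have h : v (1 - x^-1) = 0 by apply: v_max; rewrite // vV // oppr_gt0.
have n : 1 - x^-1 != 0.
  rewrite subr_eq0 eq_sym invr_eq1; apply: contraTneq vx => ->.
  by rewrite v_1 ltxx.
have -> : 1 - x = - x * (1 - x^-1) by field.
by rewrite vM ?oppr_eq0 // h vN // addr0.
Qed.

(** Here a, b, p, q stand for the valuations of x, y, 1 - x, 1 - y, so p - a is that of 1 - 1/x. The
    sum is 3 or -3 exactly when a and b have strictly opposite signs, which is why the sign is a
    homomorphism only modulo 3. *)
Lemma sgz_five_term (a b p q : int) :
  (0 < a -> p = 0) -> (a = 0 -> 0 < p) -> (a < 0 -> p = a) ->
  (0 < b -> q = 0) -> (b = 0 -> 0 < q) -> (b < 0 -> q = b) ->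
  (sgz a - sgz b + sgz (b - a) - sgz (p - a - (q - b)) + sgz (p - q) 
     \in [:: 0; 3; -3]).
Proof.
move=> pa p0 pn qa q0 qn; rewrite !inE.
case: (sgzP a) => ha; case: (sgzP b) => hb; case: (sgzP (b - a)) => h1;
case: (sgzP (p - q)) => h2; case: (sgzP (p - a - (q - b))) => h3; lia.
Qed.

Definition sgv (z : punct F) : 'Z_3 := (sgz (v (val z)))%:~R.

Lemma sgv_five_term r : five_term r -> fgext sgv r = 0.
Proof.
case=> [x [y [u [w [t [xy Eu Ew Et ->]]]]]].
rewrite raddfD raddfB raddfD raddfB /= !fgextU /sgv {}Eu {}Ew {}Et.
have {xy} := valP x; have := valP y; move: (val x) (val y) => {}x {}y.
move=> /andP[y0 y1] /andP[x0 x1].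
have X1 : 1 - x != 0 by rewrite subr_eq0 eq_sym.
have Y1 : 1 - y != 0 by rewrite subr_eq0 eq_sym.
have e (z : F) : z != 0 -> 1 - z^-1 = - (1 - z) / z by move=> z0; field.
rewrite !e // -!intrB -!intrD -!intrB -!intrD.
rewrite !(vM, vV, vN) ?invr_eq0 ?mulf_neq0 ?oppr_eq0 ?invr_neq0 ?oppr_eq0 //.
have := @sgz_five_term (v x) (v y) (v (1 - x)) (v (1 - y)) (v_max x0)
  (v_unit x0 x1) (v_pole x0) (v_max y0) (v_unit y0 y1) (v_pole y0).
by rewrite !inE => /or3P[] /eqP ->; apply: val_inj.
Qed.

Definition sgv_brk : preBloch F -> 'Z_3 := zlift sgv_five_term.
HB.instance Definition _ := GRing.isZmodMorphism.Build (preBloch F) 'Z_3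
  sgv_brk (zlift_is_additive sgv_five_term).

Lemma sgv_brkE z : sgv_brk (brk z) = (sgz (v (val z)))%:~R.
Proof. by rewrite /sgv_brk /brk zliftE /= fgextU. Qed.
End ValuationSign.

(** * The valuation above 2 *)

Section DyadicValuation.
Variables (F : fieldType) (al : F).
Hypothesis al2 : al ^+ 2 = al - 4.
Hypothesis char0 : forall n : int, n%:~R = 0 :> F -> n = 0.
Implicit Types (a b c d k l : int) (x y : F).

(** For [al] = (1 + sqrt(-15))/2 these are the integers of Q(sqrt(-15)). Modulo 2 the polynomial X^2
    - X + 4 is X(X - 1), so 2 splits. *)
Definition lat a b : F := a%:~R + b%:~R * al.

Lemma latM a b c d :
  lat a b * lat c d = lat (a * c - 4 * b * d) (a * d + b * c + b * d).
Proof. by rewrite /lat !(rmorphB, rmorphD, rmorphM) /=; ring: al2. Qed.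

Lemma latB a b c d : lat a b - lat c d = lat (a - c) (b - d).
Proof. by rewrite /lat !rmorphB; ring. Qed.

(** The conjugate of [al] is 1 - [al], so the second factor is the conjugate of the first. *)
Lemma lat_norm a b :
  lat a b * lat (a + b) (- b) = (a ^+ 2 + a * b + 4 * b ^+ 2)%:~R.
Proof.
rewrite latM /lat (_ : _ + _ * - b = 0) ?mul0r ?addr0; last by ring.
by congr _%:~R; ring.
Qed.

Lemma lat_eq0 a b : lat a b = 0 -> a = 0 /\ b = 0.
Proof.
move=> ab0; have := lat_norm a b; rewrite ab0 mul0r => /esym/char0.
move=> N0; have : b = 0 by nia.
move=> b0; split=> //; move: N0; rewrite b0; nia.
Qed.

(* Modulo the prime (2, al), the residue of [lat a b] is the parity of [a]. *)
Definition lodd x := exists a b, x = lat (1 + 2 * a) b.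
Definition leven x := exists a b, x = lat (2 * a) b.

Lemma lodd_neven x : lodd x -> ~ leven x.
Proof.
move=> [a [b ->]] [c [d e]].
have /lat_eq0[] : lat (1 + 2 * a - 2 * c) (b - d) = 0 by rewrite -latB e subrr.
lia.
Qed.

Lemma lodd_neq0 x : lodd x -> x != 0.
Proof.
move=> o; apply/eqP => x0; apply: (lodd_neven o).
by exists 0, 0; rewrite x0 /lat !rmorph0 mul0r addr0.
Qed.

Lemma loddM x y : lodd x -> lodd y -> lodd (x * y).
Proof.
move=> [a [b ->]] [c [d ->]]; rewrite latM.
exists (a + c + 2 * a * c - 2 * b * d),
  ((1 + 2 * a) * d + b * (1 + 2 * c) + b * d).
by congr lat; ring.
Qed.

Lemma levenM x y : leven x -> lodd y -> leven (x * y).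
Proof.
move=> [a [b ->]] [c [d ->]]; rewrite latM.
exists (a * (1 + 2 * c) - 2 * b * d), (2 * a * d + b * (1 + 2 * c) + b * d).
by congr lat; ring.
Qed.

Lemma leven_mulz x a : leven x -> leven (x * a%:~R).
Proof.
move=> [c [d ->]]; exists (c * a), (d * a).
by rewrite /lat !rmorphM /=; ring.
Qed.

Lemma loddB x y : lodd x -> leven y -> lodd (x - y).
Proof.
move=> [a [b ->]] [c [d ->]]; rewrite latB.
by exists (a - c), (b - d); congr lat; ring.
Qed.

Lemma levenB x y : lodd x -> lodd y -> leven (x - y).
Proof.
move=> [a [b ->]] [c [d ->]]; rewrite latB.
by exists (a - c), (b - d); congr lat; ring.
Qed.

Lemma lodd_int a : lodd (1 + 2 * a)%:~R.
Proof. by exists a, 0; rewrite /lat mul0r addr0. Qed.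

Lemma lodd1 : lodd 1. Proof. exact: (lodd_int 0). Qed.

Lemma leven_pow2 n x : lodd x -> leven (2 ^+ n.+1 * x).
Proof.
move=> [a [b ->]]; exists (2 ^+ n * (1 + 2 * a)), (2 ^+ n.+1 * b).
by rewrite /lat !(rmorphM, rmorphXn) /= exprS; ring.
Qed.

Lemma two_F_neq0 : 2 != 0 :> F.
Proof. by apply/eqP => /(char0 (n := 2)). Qed.

(* The units of the localisation of Z[al] at (2, al). *)
Definition lunit x := exists u w, [/\ lodd u, lodd w & x = u / w].

Lemma lunit_lodd x : lodd x -> lunit x.
Proof. by move=> o; exists x, 1; split; rewrite ?divr1 //; exact: lodd1. Qed.

Lemma lunitM x y : lunit x -> lunit y -> lunit (x * y).
Proof.
move=> [u [w [ou ow ->]]] [u' [w' [ou' ow' ->]]].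
by exists (u * u'), (w * w'); rewrite mulf_div; split=> //; apply: loddM.
Qed.

Lemma lunitV x : lunit x -> lunit x^-1.
Proof. by move=> [u [w [ou ow ->]]]; exists w, u; rewrite invf_div. Qed.

Lemma lunit_neq0 x : lunit x -> x != 0.
Proof.
by move=> [u [w [ou ow ->]]]; rewrite mulf_neq0 ?invr_eq0 ?lodd_neq0.
Qed.

(** This makes the exponent in [dyadic] unique: a positive power of 2 equal to u/w would make the
    odd element u even. *)
Lemma lunit_pow2 k : lunit (2 ^ k) -> k = 0.
Proof.
have pos n : ~ lunit (2 ^+ n.+1).
  move=> [u [w [ou ow e]]]; apply: (lodd_neven ou).
  by rewrite -(divfK (lodd_neq0 ow) u) -e; apply: leven_pow2.
case: k => [[|n]|n] //; first by move/pos.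
by move/lunitV; rewrite NegzE -exprnN invrK => /pos.
Qed.

(* Every nonzero element is a power of 2 times a unit: (2, al) is unramified of
   degree one, so 2 is a uniformiser. *)
Definition dyadic x := exists k y, lunit y /\ x = 2 ^ k * y.

Lemma dyadicM x y : dyadic x -> dyadic y -> dyadic (x * y).
Proof.
move=> [k [u [hu ->]]] [l [w [hw ->]]]; exists (k + l), (u * w).
by split; [exact: lunitM | rewrite expfzDr ?two_F_neq0 // mulrACA].
Qed.

Lemma dyadicV x : dyadic x -> dyadic x^-1.
Proof.
move=> [k [u [hu ->]]]; exists (- k), u^-1.
by split; [exact: lunitV | rewrite invfM -invr_expz].
Qed.

Lemma dyadic_lodd x : lodd x -> dyadic x.
Proof.
by move=> o; exists 0, x; rewrite expr0z mul1r; split=> //; exact: lunit_lodd.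
Qed.

Lemma dyadic2 : dyadic 2.
Proof.
by exists 1, 1; rewrite expr1z mulr1; split=> //; exact/lunit_lodd/lodd1.
Qed.

Lemma dyadic_int a : a != 0 -> dyadic a%:~R.
Proof.
elim: {a}(`|a|%N.+1) {-2}a (ltnSn `|a|%N) => // N IH a aN a0.
have [e|e] : a = 1 + 2 * (a %/ 2)%Z \/ a = 2 * (a %/ 2)%Z by lia.
  by apply: dyadic_lodd; rewrite e; exact: lodd_int.
by rewrite e rmorphM /=; apply: dyadicM dyadic2 (IH _ _ _); lia.
Qed.

(* If [a] is even and [b] odd then the conjugate of [lat a b] is odd, and
   [lat a b] is the norm divided by this conjugate. *)
Lemma dyadic_lat a b : lat a b != 0 -> dyadic (lat a b).
Proof.
elim: {a b}((`|a| + `|b|)%N.+1) {-2}a {-2}b (ltnSn (`|a| + `|b|)%N) => //.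
move=> N IH a b abN ab0.
have [//|e] : dyadic (lat a b) \/ a = 2 * (a %/ 2)%Z.
  have [e|e] : a = 1 + 2 * (a %/ 2)%Z \/ a = 2 * (a %/ 2)%Z by lia.
    by left; apply: dyadic_lodd; exists (a %/ 2)%Z, b; rewrite -e.
  by right.
have [f|f] : b = 1 + 2 * (b %/ 2)%Z \/ b = 2 * (b %/ 2)%Z by lia.
  have oc : lodd (lat (a + b) (- b)).
    by exists ((a %/ 2)%Z + (b %/ 2)%Z), (- b); congr lat; lia.
  rewrite -(mulfK (lodd_neq0 oc) (lat a b)) lat_norm.
  apply: dyadicM; last exact/dyadicV/dyadic_lodd.
  by apply: dyadic_int; nia.
have E : lat a b = 2 * lat (a %/ 2)%Z (b %/ 2)%Z.
  by rewrite {1}e {1}f /lat !rmorphM /=; ring.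
move: ab0; rewrite E mulf_eq0 negb_or => /andP[_ ab0].
apply: dyadicM dyadic2 (IH _ _ _ ab0).
(* Halving lowers |a| + |b| only if a and b are not both 0. *)
have : ~ (a = 0 /\ b = 0); last by lia.
move=> [a0 b0]; move: ab0.
by rewrite a0 b0 /lat !div0z !rmorph0 mul0r addr0 eqxx.
Qed.

Definition lat_frac x := exists a b c d, lat c d != 0 /\ x = lat a b / lat c d.

(** Serves to show that the subfield generated by sqrt(-15), being the smallest division-closed set
    containing it, consists of such fractions. *)
Lemma lat_frac_closed : divring_closed [pred x | `[< lat_frac x >]].
Proof.
have lat1 : lat 1 0 = 1 by rewrite /lat rmorph1 rmorph0 mul0r addr0.
have n1 : lat 1 0 != 0 by rewrite lat1 oner_eq0.
have one : lat_frac 1 by exists 1, 0, 1, 0; rewrite divff.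
have zero : lat_frac 0.
  by exists 0, 0, 1, 0; split=> //; rewrite /lat !rmorph0 !mul0r addr0 mul0r.
split=> [|x y|x y]; rewrite !inE; first exact/asboolP.
  move=> /asboolP[a [b [c [d [n ->]]]]] /asboolP[a' [b' [c' [d' [n' ->]]]]].
  apply/asboolP; rewrite -mulNr addf_div // mulNr !latM latB.
  by eexists _, _, _, _; split; last reflexivity; rewrite -latM mulf_neq0.
move=> /asboolP[a [b [c [d [n ->]]]]] /asboolP[a' [b' [c' [d' [n' ->]]]]].
apply/asboolP; have [->|m] := eqVneq (lat a' b') 0.
  by rewrite mul0r invr0 mulr0.
rewrite invf_div mulf_div !latM.
by eexists _, _, _, _; split; last reflexivity; rewrite -latM mulf_neq0.
Qed.

Hypothesis frac : forall x, lat_frac x.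

Lemma dyadicP x : x != 0 -> dyadic x.
Proof.
have [a [b [c [d [cd0 ->]]]]] := frac x.
rewrite mulf_eq0 negb_or => /andP[ab0 _].
by apply: dyadicM; [|apply: dyadicV]; apply: dyadic_lat.
Qed.

(* Junk value 0 at [x = 0]. *)
Definition dval x : int :=
  if pselect (dyadic x) is left e then projT1 (cid e) else 0.

Lemma dvalP k y : lunit y -> dval (2 ^ k * y) = k.
Proof.
move=> hy; rewrite /dval; case: pselect => [e|[]]; last by exists k, y.
case: (cid e) => l /= [u [hu E]].
have y0 := lunit_neq0 hy.
suff : lunit (2 ^ (l - k)) by move/lunit_pow2/eqP; rewrite subr_eq0 => /eqP.
have u0 := lunit_neq0 hu.
have -> : 2 ^ (l - k) = y / u :> F.
  rewrite expfzDr ?two_F_neq0 // -invr_expz; apply: (mulIf u0).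
  by rewrite divfK // mulrAC -E mulrAC divff ?mul1r // expfz_neq0 ?two_F_neq0.
by apply: lunitM => //; apply: lunitV.
Qed.

Lemma dvalM x y : x != 0 -> y != 0 -> dval (x * y) = dval x + dval y.
Proof.
move=> /dyadicP[k [u [hu ->]]] /dyadicP[l [w [hw ->]]].
rewrite mulrACA -expfzDr ?two_F_neq0 // !dvalP //; exact: lunitM.
Qed.

Lemma dval_max x : x != 0 -> 0 < dval x -> dval (1 - x) = 0.
Proof.
move=> /dyadicP[k [y [hy ->]]]; rewrite dvalP //.
case: k => [[|k]|k] // _; case: hy => [u [w [ou ow ->]]].
have -> : 1 - 2 ^ k.+1%:Z * (u / w) = 2 ^ (0 : int) * ((w - 2 ^+ k.+1 * u) / w).
  by rewrite expr0z mul1r mulrBl divff ?lodd_neq0 // mulrA.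
apply: dvalP; exists (w - 2 ^+ k.+1 * u), w; split=> //.
by apply: loddB => //; apply: leven_pow2.
Qed.

(** For a unit y = u/w the numerator w - u of 1 - y is even. If 1 - y had exponent -n <= 0, clearing
    denominators would equate the even (w - u) w' 2^n with the odd u' w. *)
Lemma dval_unit x : x != 0 -> x != 1 -> dval x = 0 -> 0 < dval (1 - x).
Proof.
move=> /dyadicP[k [y [hy ->]]]; rewrite dvalP // => + k0.
rewrite {}k0 expr0z mul1r => y1.
have /dyadicP[l [z [hz e]]] : 1 - y != 0 by rewrite subr_eq0 eq_sym.
rewrite e dvalP // ltNge; apply/negP => l0.
case: hy hz e => [u [w [ou ow ->]]] [u' [w' [ou' ow' ->]]] e.
have [n En] : exists n : nat, l = - n%:Z by exists `|l|%N; lia.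
have E : (w - u) * w' * 2 ^+ n = u' * w.
  have w0 := lodd_neq0 ow; have w'0 := lodd_neq0 ow'.
  have -> : w - u = (1 - u / w) * w by field.
  rewrite e En -exprnN; move: (2 ^+ n) (expf_neq0 n two_F_neq0) => t t0.
  by field; rewrite w'0.
apply: (lodd_neven (loddM ou' ow)); rewrite -E.
rewrite -(rmorphXn (intmul 1) n 2).
exact/leven_mulz/levenM/ow'/levenB.
Qed.
End DyadicValuation.

(** * The field Q(sqrt(-15)) *)

Section K15.
Variable R : realType.
Local Open Scope complex_scope.
Local Notation K := (K15 R).

Fact rat_K15_subproof (q : rat) : (ratr q : R[i]) \in gen_subfield (sqrtm15 R).
Proof. exact: rpred_rat. Qed.

Definition rat_K15 (q : rat) : K := GenField (rat_K15_subproof q).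

Fact rat_K15_is_zmod_morphism : zmod_morphism rat_K15.
Proof. by move=> p q; apply: val_inj; rewrite /= rmorphB. Qed.
Fact rat_K15_is_monoid_morphism : monoid_morphism rat_K15.
Proof. by split=> [|p q]; apply: val_inj; rewrite /= ?rmorph1 ?rmorphM. Qed.
HB.instance Definition _ :=
  GRing.isZmodMorphism.Build rat K rat_K15 rat_K15_is_zmod_morphism.
HB.instance Definition _ :=
  GRing.isMonoidMorphism.Build rat K rat_K15 rat_K15_is_monoid_morphism.

Definition s15 : K := GenField (gen_subfield_gen (sqrtm15 R)).

Lemma s15_sqr : s15 ^+ 2 = - 15.
Proof.
by apply: val_inj; rewrite rmorphXn rmorphN (rmorph_nat _ 15) /= sqrtm15_sqr.
Qed.

Lemma brk_qtbrk (z : punct K) (p q : rat) :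
  cval z = (ratr p : R) +i* (ratr q * Num.sqrt 15) ->
  brk z = qtbrk rat_K15 s15 (p, q).
Proof.
move=> e; rewrite -tbrk_val /qtbrk; congr tbrk; apply: val_inj.
rewrite /qpt rmorphD rmorphM /= -[LHS]/(cval z) e.
rewrite -!(fmorph_rat (real_complex R)); apply/eqP.
by rewrite eq_complex /= !mul0r !mulr0 subr0 !addr0 add0r !eqxx.
Qed.

Lemma betaW_half : betaW R = brk (ptHalf R) *+ 4.
Proof.
have rE := (rmorphN, fmorph_div, rmorph1, rmorph_nat, rmorph0).
have e10 : brk (A10 R) = qtbrk rat_K15 s15 (-2, 0).
  apply: brk_qtbrk; rewrite pointK !rE mul0r -[RHS]/(real_complex R (- 2)).
  by rewrite rmorphN rmorph_nat.
have eh : brk (ptHalf R) = qtbrk rat_K15 s15 (1 / 2, 0).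
  apply: brk_qtbrk; rewrite pointK !rE mul0r -[RHS]/(real_complex R (1 / 2)).
  by rewrite !rE.
have e01 : brk (A01 R) = qtbrk rat_K15 s15 (- (1 / 8), 1 / 8).
  by apply: brk_qtbrk; rewrite pointK !rE /cA01; congr (_ +i* _); field.
have e01c : brk (conjK (A01 R)) = qtbrk rat_K15 s15 (- (1 / 8), - (1 / 8)).
  by apply: brk_qtbrk; rewrite conjKE pointK !rE /=; congr (_ +i* _); field.
have e23 : brk (A23 R) = qtbrk rat_K15 s15 (- (3 / 4), 1 / 4).
  by apply: brk_qtbrk; rewrite pointK !rE /cA23; congr (_ +i* _); field.
have e23c : brk (conjK (A23 R)) = qtbrk rat_K15 s15 (- (3 / 4), - (1 / 4)).
  by apply: brk_qtbrk; rewrite conjKE pointK !rE /=; congr (_ +i* _); field.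
have e32 : brk (A32 R) = qtbrk rat_K15 s15 (1 / 2, - (1 / 6)).
  by apply: brk_qtbrk; rewrite pointK !rE /cA32; congr (_ +i* _); field.
have e32c : brk (conjK (A32 R)) = qtbrk rat_K15 s15 (1 / 2, 1 / 6).
  by apply: brk_qtbrk; rewrite conjKE pointK !rE /=; congr (_ +i* _); field.
rewrite /betaW e10 eh e01 e01c e23 e23c e32 e32c.
exact: whitehead_relation s15_sqr.
Qed.

Lemma val_ptHalf : val (ptHalf R) = 2^-1 :> K.
Proof. by apply: val_inj; rewrite fmorphV rmorph_nat /= div1r. Qed.

Lemma brk_half_torsion : brk (ptHalf R) *+ 12 = 0.
Proof.
rewrite -tbrk_val val_ptHalf -(qpt_half rat_K15 s15).
exact: qtbrk_half_torsion s15_sqr.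
Qed.

Definition al15 : K := (1 + s15) / 2.

Lemma K15_char0 (n : int) : n%:~R = 0 :> K -> n = 0.
Proof.
by move/eqP; rewrite -(rmorph_int rat_K15) fmorph_eq0 intr_eq0 => /eqP.
Qed.

Lemma al15_sqr : al15 ^+ 2 = al15 - 4.
Proof.
have n2 : 2 != 0 :> K by apply/eqP => /(@K15_char0 2).
by rewrite /al15; field: s15_sqr.
Qed.

Lemma K15_lat_frac (x : K) : lat_frac al15 x.
Proof.
have n2 : 2 != 0 :> R[i] by rewrite pnatr_eq0.
have s2 := sqrtm15_sqr R.
pose al : R[i] := (1 + sqrtm15 R) / 2.
have al2 : al ^+ 2 = al - 4 by rewrite /al; field: s2.
have vl a b : val (lat al15 a b : K) = lat al a b.
  rewrite /lat rmorphD rmorphM !rmorph_int.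
  by rewrite fmorph_div rmorphD rmorph1 rmorph_nat.
have : lat_frac al (val x).
  have /asboolP/(_ _ (lat_frac_closed al2))/[!inE] := valP x.
  move=> /(_ _)/asboolP; apply.
  (* sqrt(-15) = 2 [al] - 1. *)
  apply/asboolP; exists (-1), 2, 1, 0; rewrite /lat /al.
  by rewrite rmorph1 rmorph0 mul0r addr0 oner_neq0; split=> //; field.
move=> [a [b [c [d]]]]; rewrite -!vl => -[n e].
exists a, b, c, d; split; first by apply: contra_neq n => ->; rewrite rmorph0.
by apply: val_inj; rewrite e fmorph_div.
Qed.

(** As 1 - 1/2 = 1/2, the image is a wedge a with itself, which antisymmetry makes 2-torsion. *)
Lemma delta_brk_half : delta (brk (ptHalf R)) *+ 2 = 0.
Proof.
rewrite delta_brk /delta_gen; set a := FUnit _; set b := FUnit _.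
have -> : b = a.
  have n2 : 2 != 0 :> K by apply/eqP => /(@K15_char0 2).
  apply: val_inj; change (1 - val (ptHalf R) = val (ptHalf R)).
  by rewrite val_ptHalf; field.
by rewrite mulr2n {1}wedgeC addNr.
Qed.

Definition sgv15 : {additive preBloch K -> 'Z_3} :=
  sgv_brk (dvalM al15_sqr K15_char0 K15_lat_frac)
    (dval_max al15_sqr K15_char0 K15_lat_frac)
    (dval_unit al15_sqr K15_char0 K15_lat_frac).

Lemma sgv15_half : sgv15 (brk (ptHalf R)) = -1.
Proof.
rewrite /sgv15 /= sgv_brkE val_ptHalf -[2^-1]mulr1 -[2^-1]/(2 ^ (-1)).
by rewrite (dvalP al15_sqr K15_char0) //; exact/lunit_lodd/lodd1.
Qed.
End K15.

Theorem proposition5p5 (R : realType) :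
  [/\ betaW R = brk (ptHalf R) *+ 4,
      delta (betaW R) = 0
    & exists hb : betaW R \in bloch (K15 R),
        has_order (MkBloch hb) 3].
Proof.
have db : delta (betaW R) = 0.
  by rewrite betaW_half raddfMn (mulrnA _ 2 2) delta_brk_half mul0rn.
split=> //; first exact: betaW_half.
have hb : betaW R \in bloch (K15 R) by rewrite blochE db.
exists hb; split=> //.
  by apply: val_inj; rewrite raddfMn /= betaW_half -mulrnA brk_half_torsion.
(* [sgv15] sends m beta(W) to -4m = -m in Z/3, which is nonzero for m = 1, 2. *)
move=> m /andP[m0 m3] /(congr1 (@bval _)); rewrite raddfMn raddf0 /= betaW_half.
move=> /(congr1 (sgv15 R)); rewrite raddf0 !raddfMn /= sgv15_half.
by case: m m0 m3 => [|[|[|]]].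
Qed.
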